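(* Let $G$ be a non-archimedean Polish group with a fundamental action $G\curvearrowright\mathbb N$, and consider the Bernoulli shift action of $G$ on $\mathbb R^{\mathbb N}$. Then $G$ is not locally compact if and only if the $G$-space $\mathbb R^{\mathbb N}$ satisfies the following: for every open neighborhood $V$ of the identity of $G$, for every $G$-invariant comeager subset $C$ of $\mathbb R^{\mathbb N}$ and for every non-meager subset $O$ of $\mathbb R^{\mathbb N}$ there are $c\in C$ and $o\in O$ so that $c\succeq_V o$ but $[c]\neq[o]$.
   Context: A non-archimedean Polish group is a Polish group admitting a neighborhood basis at the identity consisting of open subgroups. Such a group can be written (up to topological isomorphism) as $G=\mathrm{Aut}(\mathcal N)\subseteq \mathrm{Sym}(\mathbb N)$ for a structure $\mathcal N$ with universe $\mathbb N$ in a countable language; equivalently $G$ is a closed subgroup of $\mathrm{Sym}(\mathbb N)$ (the group of all permutations of $\mathbb N$ with the pointwise convergence topology). The resulting action $G\curvearrowright\mathbb N$ is called a fundamental action. The Bernoulli shift for $G$ is the action of $G$ on the space $\mathbb R^{\mathbb N}$ (product topology) given by $(g\cdot x)(n)=x(g^{-1}(n))$. $[x]$ denotes the $G$-orbit of $x$. For $x,y$ in a Polish $G$-space and an open neighborhood $V$ of $1$ in $G$, $x\succeq_V y$ means that there are $g_*\in G$ and a sequence $(g_n)$ in $V$ such that $g_n g_* x\to y$ as $n\to\infty$. *)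

(* Defs.v *)
From HB Require Import structures.
From mathcomp Require Import all_boot all_order all_algebra.
From mathcomp Require Import all_classical all_reals all_analysis.

Set Implicit Arguments.
Unset Strict Implicit.
Unset Printing Implicit Defensive.

Import Order.TTheory GRing.Theory Num.Theory.
Import numFieldNormedType.Exports.

Local Open Scope classical_set_scope.
Local Open Scope ring_scope.

(* Multiplicative counterpart of topologicalZmodType; not assumed Hausdorff. *)
HB.mixin Record isTopologicalGroup G & Topological G & Group G := {
  mulg_continuous : continuous (fun x : G * G => (x.1 * x.2)%g) ;
  invg_continuous : continuous (fun x : G => (x^-1)%g) ;
}.

#[short(type="topologicalGroupType")]
HB.structure Definition TopologicalGroup :=
  {G of Topological G & Group G & isTopologicalGroup G}.

Definition separable (T : topologicalType) :=
  exists2 D : set T, countable D & dense D.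

Definition is_metric (R : realType) (T : Type) (d : T -> T -> R) :=
  [/\ forall x y, 0 <= d x y,
      forall x y, d x y = 0 <-> x = y,
      forall x y, d x y = d y x &
      forall x y z, d x z <= d x y + d y z].

Definition metrizes (R : realType) (T : topologicalType) (d : T -> T -> R) :=
  forall x : T, nbhs x =
    filter_from [set e : R | 0 < e] (fun e => [set y | d x y < e]).

Definition complete_metric (R : realType) (T : topologicalType)
    (d : T -> T -> R) :=
  forall u : nat -> T,
    (forall e : R, 0 < e ->
       exists N : nat, forall m n : nat,
         (N <= m)%N -> (N <= n)%N -> d (u m) (u n) < e) ->
    exists l : T, u @ \oo --> l.

Definition polish (R : realType) (T : topologicalType) :=
  separable T /\
  exists d : T -> T -> R, [/\ is_metric d, metrizes d & complete_metric d].

Definition is_subgroup (G : groupType) (H : set G) :=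
  [/\ H 1%g, forall g h, H g -> H h -> H (g * h)%g &
      forall g, H g -> H (g^-1)%g].

Definition non_archimedean (G : topologicalGroupType) :=
  forall U : set G, nbhs (1%g : G) U ->
    exists H : set G, [/\ open H, is_subgroup H & H `<=` U].

Definition nowhere_dense (T : topologicalType) (A : set T) :=
  (closure A)° = set0.

Definition meager (T : topologicalType) (A : set T) :=
  exists2 F : nat -> set T,
    forall n, nowhere_dense (F n) & A `<=` \bigcup_n F n.

Definition comeager (T : topologicalType) (A : set T) := meager (~` A).

(* Sym(N): the inverse is carried as data, but by symN_inj two permutations
   with the same underlying function are equal. *)
Record symN := SymN {
  symN_fun :> nat -> nat ;
  symN_inv : nat -> nat ;
  symN_funK : cancel symN_fun symN_inv ;
  symN_invK : cancel symN_inv symN_fun }.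

Lemma symN_inj (f g : symN) : (forall n, f n = g n) -> f = g.
Proof.
case: f g => [f f' fK f'K] [g g' gK g'K] /= fg.
have {}fg : f = g by exact/funext.
subst g; have fg' : f' = g'.
  by apply/funext => n; rewrite -[in LHS](g'K n) fK.
by subst g'; congr SymN; exact: Prop_irrelevance.
Qed.

Definition symN_one : symN := @SymN id id (fun=> erefl) (fun=> erefl).

Definition symN_mul (f g : symN) : symN :=
  SymN (can_comp (symN_funK f) (symN_funK g))
       (can_comp (symN_invK g) (symN_invK f)).

Definition symN_invg (f : symN) : symN := SymN (symN_invK f) (symN_funK f).

HB.instance Definition _ := gen_eqMixin symN.
HB.instance Definition _ := gen_choiceMixin symN.

Fact symN_mulA : associative symN_mul.
Proof. by move=> f g h; exact: symN_inj. Qed.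
Fact symN_mul1g : left_id symN_one symN_mul.
Proof. by move=> f; exact: symN_inj. Qed.
Fact symN_mulg1 : right_id symN_one symN_mul.
Proof. by move=> f; exact: symN_inj. Qed.
Fact symN_mulVg : left_inverse symN_one symN_invg symN_mul.
Proof. by move=> f; apply: symN_inj => n /=; rewrite symN_funK. Qed.
Fact symN_mulgV : right_inverse symN_one symN_invg symN_mul.
Proof. by move=> f; apply: symN_inj => n /=; rewrite symN_invK. Qed.

HB.instance Definition _ := isGroup.Build symN
  symN_mulA symN_mul1g symN_mulg1 symN_mulVg symN_mulgV.

(* Pointwise convergence, nat being discrete. *)
HB.instance Definition _ := Topological.copy symN
  (initial_topology (symN_fun : symN -> {ptws nat -> nat})).

Lemma symN_cvgP (F : set_system symN) (f : symN) : Filter F ->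
  (F --> f) <-> forall n : nat, F [set g : symN | g n = f n].
Proof.
move=> FF.
have ptwP := @pointwise_cvgP nat nat (symN_fun @ F) (symN_fun f)
  (fmap_filter symN_fun FF).
split=> [Ff n|Ff].
  have /ptwP/(_ n) : (symN_fun @ F : set_system {ptws nat -> nat})
                       --> (symN_fun f : {ptws nat -> nat}).
    apply: (cvg_trans (cvg_app symN_fun Ff)).
    exact: (@initial_continuous symN {ptws nat -> nat} symN_fun f).
  by move=> /(_ [set f n]); apply; exact: discrete_set1.
have /ptwP ptw : forall n, (fun g : nat -> nat => g n) @ (symN_fun @ F) --> f n.
  move=> n A /nbhs_singleton Afn.
  apply: (@filterS _ F _ [set g : symN | g n = f n] _ _ (Ff n)) => g gn.
  by rewrite /preimage /= gn.
move=> A [_ [[B oB <-] Bf sBA]].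
have nB : nbhs (symN_fun f : {ptws nat -> nat}) B by exact: open_nbhs_nbhs.
exact: filterS sBA (ptw _ nB).
Qed.

Fact symN_mulg_continuous :
  continuous (fun x : symN * symN => (x.1 * x.2)%g).
Proof.
move=> [f g]; apply/symN_cvgP => n.
have /symN_cvgP/(_ (g n)) nf : nbhs f --> f by [].
have /symN_cvgP/(_ n) ng : nbhs g --> g by [].
exists ([set h : symN | h (g n) = f (g n)], [set h : symN | h n = g n]) => //=.
by move=> [h k] /= [hE kE]; rewrite -[LHS]/(h (k n)) kE hE.
Qed.

Fact symN_invg_continuous : continuous (fun x : symN => (x^-1)%g).
Proof.
move=> f.
apply/(@symN_cvgP _ _ (fmap_filter _ (nbhs_filter f))) => n.
have /symN_cvgP/(_ (symN_inv f n)) nf : nbhs f --> f by [].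
apply: (@filterS _ (nbhs f) _ _ _ _ nf) => h /= hE.
rewrite -[LHS]/(symN_inv h n) -[RHS]/(symN_inv f n).
by rewrite -[in LHS](symN_invK f n) -hE symN_funK.
Qed.

HB.instance Definition _ := isTopologicalGroup.Build symN
  symN_mulg_continuous symN_invg_continuous.

(* A fundamental action of G, given as a homomorphism into Sym(N) that is a
   homeomorphism onto a closed subgroup. *)
Definition fundamental_action (G : topologicalGroupType) (a : G -> symN) :=
  [/\ forall g h : G, a (g * h)%g = (a g * a h)%g,
      injective a,
      forall U : set G, open U <-> exists2 W : set symN, open W & a @^-1` W = U &
      closed (range a)].

Definition bernoulli (R : realType) (G : topologicalGroupType) (a : G -> symN)
    (g : G) (x : {ptws nat -> R}) : {ptws nat -> R} :=
  fun n => x (a (g^-1)%g n).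

Section ActionOnSpace.
Variables (G : topologicalGroupType) (X : topologicalType) (act : G -> X -> X).

Definition act_orbit (x : X) : set X := [set act g x | g in [set: G]].

Definition act_invariant (C : set X) := forall g x, C x -> C (act g x).

Definition succeq (V : set G) (x y : X) :=
  exists (gs : G) (g : nat -> G),
    (forall n, V (g n)) /\ act (g n * gs)%g x @[n --> \oo] --> y.

End ActionOnSpace.

(* Main.v *)
Require Import Defs.
From mathcomp Require Import all_boot all_order all_algebra.
From mathcomp Require Import all_classical all_reals all_analysis.
Import Order.TTheory GRing.Theory Num.Theory.
Import numFieldNormedType.Exports.
Local Open Scope classical_set_scope.
Local Open Scope ring_scope.

(** Compactness in one direction.  If [K] is a compact neighbourhood of the
identity and [V] is its interior, then a witness [g_n g_* x --> y] of
[x] succeeding [y] over [V] has a cluster point [k] of the [g_n] in [K], and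
continuity of the action forces [k g_* x = y].  So with everything for [C] and
[O] (the sequence space is a Baire space) no pair with distinct orbits exists:
[succeq_compact_orbit] and [baire_sequence_space].

For the other direction, shrink [V] to an open subgroup [H], which is not
compact.  The heart of the proof is that there are a point [n0] and, for each
[N], an element [h] of [H] which pushes [n0] beyond [N] and leaves every
[b < N] either where it is or pushes it beyond [N] as well
([noncompact_open_subgroup_mobile]).  It is obtained from an ultrafilter on [H]
without limit: [h] is a quotient [j^-1 k] of two elements that are typical for
this ultrafilter.

Now let [raise n0 1 o] be [o] with 1 added to its value at [n0].  Given the
first [N] values of [o], the values of [o] at the places beyond [N] are free, so
they can be chosen to make [raise n0 1 o] composed with [h] agree with [o] on
[0, N): the place [n0] where the two sequences differ is out of sight.  Hence
for generic [o], translates of [raise n0 1 o] by elements of [H] converge to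
[o] ([raise_approximable]).  Moreover for generic [o] the number [o n0 + 1] is
not a value of [o], while members of one orbit have the same values, so
[raise n0 1 o] is in another orbit ([raise_avoids_value]).  Finally
[raise n0 1] is a homeomorphism, so [raise n0 1 o] is in the comeager set [C]
for generic [o].  A non-meager [O] has a member with all of these
properties. *)

Set Implicit Arguments.
Unset Strict Implicit.

(** * Neighbourhoods in the space of real sequences *)
Lemma near_forall_ltn (T : Type) (F : set_system T) (FF : Filter F)
    (P : nat -> T -> Prop) (N : nat) :
  (forall i, (i < N)%N -> \forall x \near F, P i x) ->
  \forall x \near F, forall i, (i < N)%N -> P i x.
Proof.
elim: N => [|N IH] FP; first by apply: nearW.
have [FN FlN] := (FP N (ltnSn N), IH (fun i iN => FP i (ltnW iN))).
apply: filterS2 FN FlN => x PN PlN i.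
by rewrite ltnS leq_eqVlt => /predU1P[->//|/PlN].
Qed.

(** One index bounds both the number of coordinates and the tolerance, so that
these sets alone form a basis of neighbourhoods of [x]. *)
Definition box (R : realType) (x : nat -> R) (n : nat) : set {ptws nat -> R} :=
  [set y | forall i, (i < n)%N -> `|y i - x i| <= n.+1%:R^-1].

Lemma eval_continuous (R : realType) (i : nat) :
  continuous (fun x : {ptws nat -> R} => x i).
Proof.
move=> x; have /pointwise_cvgP : {ptws, nbhs x --> x} by [].
exact.
Qed.

Lemma ptws_cvgP (R : realType) (T : Type) (F : set_system T) (FF : Filter F)
    (u : T -> {ptws nat -> R}) (x : {ptws nat -> R}) :
  u @ F --> x <-> forall i, u t i @[t --> F] --> x i.
Proof.
have uP := @pointwise_cvgP nat R (u @ F) x (fmap_filter u FF).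
by split=> [ux i|ux]; [exact: (uP.1 ux i)|exact: (uP.2 ux)].
Qed.

Lemma box_nbhs (R : realType) (x : {ptws nat -> R}) n : nbhs x (box x n).
Proof.
apply: (@near_forall_ltn _ _ (nbhs_filter x)
  (fun i y => `|y i - x i| <= n.+1%:R^-1)) => i _.
have /cvgrPdist_le/(_ n.+1%:R^-1) := @eval_continuous R i x.
by rewrite invr_gt0 ltr0Sn => /(_ isT); apply: filterS => y /=; rewrite distrC.
Qed.

Lemma nbhs_box (R : realType) (x : {ptws nat -> R}) (U : set {ptws nat -> R}) :
  nbhs x U -> exists n, box x n `<=` U.
Proof.
(* Points of the boxes outside U would form a sequence converging to x. *)
move=> xU; apply: contrapT => /forallNP noU.
have /choice[u uP] n : exists y, box x n y /\ ~ U y.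
  by have /existsNP[y /not_implyP] := noU n; exists y.
have : (u : nat -> {ptws nat -> R}) @ \oo --> x.
  apply/ptws_cvgP => i; apply/cvgrPdist_le => e e0; near=> n.
  have /le_trans : `|u n i - x i| <= n.+1%:R^-1.
    by apply: (uP n).1; near: n; exists i.+1.
  rewrite /= distrC; apply.
  by apply: ltW; near: n; exact: (near_infty_natSinv_lt (PosNum e0)).
move=> /(_ _ xU) [n _ /(_ n (leqnn n))]; exact: (uP n).2.
Unshelve. all: by end_near. Qed.

(** * Baire category *)

(** Nested boxes, each avoiding one more of the nowhere dense sets: their
centers converge coordinatewise, to a point that lies in all the boxes. *)
Lemma baire_sequence_space (R : realType) : ~ meager [set: {ptws nat -> R}].
Proof.
case=> F Fnd Fcover.
pose inside (p q : {ptws nat -> R} * nat) :=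
  (p.2 < q.2)%N /\ box q.1 q.2 `<=` box p.1 p.2.
have shrink k (p : {ptws nat -> R} * nat) :
    exists q, inside p q /\ box q.1 q.2 `<=` ~` F k.
  have [y [By Fy]] : exists y, (box p.1 p.2)° y /\ ~ closure (F k) y.
    apply: contrapT => /forallNP none.
    have : (closure (F k))° p.1.
      apply: filterS (nbhs_interior (box_nbhs p.1 p.2)) => y By.
      by apply: contrapT => Fy; exact: (none y).
    by rewrite (Fnd k).
  have yFC : nbhs y (~` closure (F k)).
    by apply: open_nbhs_nbhs; split=> //; rewrite openC; exact: closed_closure.
  have [n sub] := nbhs_box (filterI (By : nbhs y _) yFC).
  have sub' : box y (maxn n p.2.+1) `<=` box y n.
    move=> z zB i iN; apply: le_trans (zB i _) _.
      by rewrite (leq_trans iN)// leq_maxl.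
    by rewrite lef_pV2 ?posrE ?ltr0Sn// ler_nat ltnS leq_maxl.
  exists (y, maxn n p.2.+1); split; last first.
    by move=> z /sub'/sub[_ Fz] Fkz; apply: Fz; exact: subset_closure.
  by split=> [|z /sub'/sub[]//]; rewrite /= leq_maxr.
have /choice[next nextP] (kp : nat * ({ptws nat -> R} * nat)) : exists q,
    inside kp.2 q /\ box q.1 q.2 `<=` ~` F kp.1.
  exact: shrink.
pose fix s k : {ptws nat -> R} * nat :=
  if k is k'.+1 then next (k', s k') else (fun=> 0, 0%N).
have sS k : inside (s k) (s k.+1) by case: (nextP (k, s k)).
have sF k : box (s k.+1).1 (s k.+1).2 `<=` ~` F k by case: (nextP (k, s k)).
have sn k : (k <= (s k).2)%N.
  by elim: k => // k IH; apply: leq_ltn_trans IH (sS k).1.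
have nested j k : (j <= k)%N -> box (s k).1 (s k).2 `<=` box (s j).1 (s j).2.
  elim: k => [|k IH]; first by rewrite leqn0 => /eqP->.
  rewrite leq_eqVlt => /predU1P[->//|/IH]; apply: subset_trans; exact: (sS k).2.
have center k : box (s k).1 (s k).2 (s k).1.
  by move=> i _; rewrite subrr normr0 invr_ge0 ler0n.
have close i j k : (i < (s j).2)%N -> (j <= k)%N ->
    `|(s k).1 i - (s j).1 i| <= (s j).2.+1%:R^-1.
  by move=> ij jk; exact: (nested _ _ jk _ (center k)).
have cvgs i : cvg ((s k).1 i @[k --> \oo]).
  apply/cauchy_cvgP/cauchy_exP => e e0.
  near \oo => j; exists ((s j).1 i); exists j => // k /= jk.
  rewrite /ball /= distrC; apply: le_lt_trans (close i j k _ jk) _.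
    by apply: leq_trans (sn j); near: j; exists i.+1.
  apply: (@le_lt_trans _ _ j.+1%:R^-1).
    by rewrite lef_pV2 ?posrE ?ltr0Sn// ler_nat ltnS.
  by near: j; exact: (near_infty_natSinv_lt (PosNum e0)).
pose l : {ptws nat -> R} := fun i => lim ((s k).1 i @[k --> \oo]).
(* The bounds that define the k-th box are closed and hold for all later
   centers, hence for their limit l. *)
have [k _ Fkl] : (\bigcup_n F n) l by exact: Fcover.
apply: (sF k l) Fkl => i ik.
have : `|(s j).1 i - (s k.+1).1 i| @[j --> \oo] --> `|l i - (s k.+1).1 i|.
  by apply: cvg_norm; apply: cvgB; [exact: cvgs|exact: cvg_cst].
move/cvgr_to_le; apply; exists k.+1 => // j kj; exact: (close i k.+1 j ik kj).
Unshelve. all: by end_near. Qed.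

Lemma open_dense_nowhere_denseC (T : topologicalType) (W : set T) :
  open W -> (forall (x : T) U, nbhs x U -> exists2 y, U y & W y) ->
  nowhere_dense (~` W).
Proof.
move=> oW dW; rewrite /nowhere_dense -subset0 => x.
rewrite closure_setC (interior_id W).1// => /dW[y]; exact.
Qed.

Lemma nowhere_dense_preimage (T : topologicalType) (f g : T -> T) (A : set T) :
  continuous f -> continuous g -> cancel f g -> cancel g f ->
  nowhere_dense A -> nowhere_dense (f @^-1` A).
Proof.
move=> cf cg fK gK A0; rewrite /nowhere_dense -subset0 => x xU.
have : (closure A)° (f x).
  have : nbhs (f x) (g @^-1` closure (f @^-1` A)).
    by apply: cg; rewrite fK.
  apply: filterS => y /= yA B; rewrite -[y]gK => /cf/yA[z [Az Bz]].
  by exists (f z).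
by rewrite A0.
Qed.

Lemma meagerU (T : topologicalType) (A B : set T) :
  meager A -> meager B -> meager (A `|` B).
Proof.
move=> [F Fnd AF] [E End BE].
(* Interleave the two sequences of nowhere dense sets. *)
exists (fun n => if odd n then F n./2 else E n./2) => [n|x].
  by case: ifP.
case=> [/AF|/BE] [n _ nx].
  by exists n.*2.+1 => //=; rewrite odd_double /= uphalf_double.
by exists n.*2 => //=; rewrite odd_double doubleK.
Qed.

(** * The group as a topological group of permutations *)

Lemma fundamental_action1 (G : topologicalGroupType) (a : G -> symN) :
  fundamental_action a -> a 1%g = 1%g.
Proof. by case=> aM _ _ _; apply: (mulgI (a 1%g)); rewrite -aM !mulg1. Qed.

Lemma fundamental_actionV (G : topologicalGroupType) (a : G -> symN) (g : G) :
  fundamental_action a -> a (g^-1)%g = ((a g)^-1)%g.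
Proof.
move=> fund_a; have [aM _ _ _] := fund_a; apply: (mulgI (a g)).
by rewrite -aM !mulgV fundamental_action1.
Qed.

Lemma fundamental_action_nbhs (G : topologicalGroupType) (a : G -> symN)
    (g : G) (B : set symN) :
  fundamental_action a -> nbhs (a g) B -> nbhs g (a @^-1` B).
Proof.
case=> _ _ aO _; rewrite nbhsE => -[W [oW Wg] WB].
apply: (@filterS _ (nbhs g) _ (a @^-1` W)); first by move=> h /WB.
by apply: open_nbhs_nbhs; split=> //; apply/aO; exists W.
Qed.

Lemma fundamental_action_near_eq (G : topologicalGroupType) (a : G -> symN)
    (g : G) (n : nat) :
  fundamental_action a -> nbhs g [set h | a h n = a g n].
Proof.
move=> fund_a.
apply: (fundamental_action_nbhs fund_a (B := [set f | f n = a g n])).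
by have /symN_cvgP/(_ n) : nbhs (a g) --> a g by [].
Qed.

(** The pointwise limits of the permutations and of their inverses are inverse
to each other, because a member of the filter realizes any finite part of both.
Without the hypothesis on the inverses the limit could fail to be onto. *)
Lemma pointwise_cvg_fundamental (G : topologicalGroupType) (a : G -> symN)
    (F : set_system G) (FF : ProperFilter F) :
  fundamental_action a ->
  (forall b, exists m, F [set h | a h b = m]) ->
  (forall b, exists m, F [set h | a (h^-1)%g b = m]) ->
  exists g : G, F --> g.
Proof.
move=> fund_a /choice[phi phiP] /choice[psi psiP].
have aVE h b : a (h^-1)%g b = symN_inv (a h) b by rewrite fundamental_actionV.
have phiK : cancel phi psi.
  move=> b; have [h [/= hb hphi]] := filter_ex (filterI (phiP b) (psiP (phi b))).
  by rewrite -hphi aVE -hb symN_funK.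
have psiK : cancel psi phi.
  move=> b; have [h [/= hb hpsi]] := filter_ex (filterI (psiP b) (phiP (psi b))).
  by rewrite -hpsi -hb aVE symN_invK.
have Fs : a @ F --> SymN phiK psiK by apply/symN_cvgP.
have [_ _ aO aclosed] := fund_a.
have [g _ ag] : range a (SymN phiK psiK).
  apply: aclosed => B /Fs FB; have [g Bg] := filter_ex (FB : F (a @^-1` B)).
  by exists (a g); split=> //; exists g.
exists g => B; rewrite nbhsE => -[U [/aO[W oW <-] Wg] sub].
by apply: filterS sub (Fs _ _); rewrite -ag; apply: open_nbhs_nbhs.
Qed.

Lemma mulg_cvg (T : Type) (G : topologicalGroupType) (F : set_system T)
    (FF : Filter F) (f g : T -> G) (x y : G) :
  f @ F --> x -> g @ F --> y -> (f t * g t)%g @[t --> F] --> (x * y)%g.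
Proof.
move=> fx gy.
have fgxy : (f t, g t) @[t --> F] --> (x, y) by exact: cvg_pair.
exact: (cvg_comp _ _ fgxy (@mulg_continuous G (x, y))).
Qed.

Lemma open_subgroup_closed (G : topologicalGroupType) (H : set G) :
  open H -> is_subgroup H -> closed H.
Proof.
move=> oH [H1 HM HV] g gH.
have : nbhs g [set x | H (x^-1 * g)%g].
  have cont : {for g, continuous (fun x : G => (x^-1 * g)%g)}.
    by apply: mulg_cvg; [exact: invg_continuous|exact: cvg_cst].
  by apply: cont; apply: open_nbhs_nbhs; rewrite mulVg.
by move/gH => [x [Hx Hxg]]; rewrite -[g](mulVKg x); apply: HM.
Qed.

Lemma compact_open_subgroup_locally_compact (G : topologicalGroupType) (H : set G) :
  open H -> is_subgroup H -> compact H -> locally_compact [set: G].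
Proof.
move=> oH sH cH g _.
have cont h : continuous (fun x : G => (h * x)%g).
  by move=> x; exact: (@mulg_cvg _ G (nbhs x) _ (fun=> h) id h x (cvg_cst h) cvg_id).
have gHE : [set (g * x)%g | x in H] = (fun x => (g^-1 * x)%g) @^-1` H.
  apply/seteqP; split=> [_ [x Hx <-]|x Hx] /=; first by rewrite mulKg.
  by exists (g^-1 * x)%g => //; rewrite mulVKg.
exists [set (g * x)%g | x in H]; last split.
- have : nbhs g ((fun x => (g^-1 * x)%g) @^-1` H).
    apply: (cont g^-1%g); apply: open_nbhs_nbhs.
    by rewrite mulVg; split=> //; have [] := sH.
  by rewrite gHE; apply: filterS => x Hx _.
- by apply: continuous_compact => //; apply: continuous_subspaceT.
- rewrite gHE; apply: closed_comp => [x _|]; first exact: cont.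
  exact: open_subgroup_closed.
Qed.

(** * Noncompact open subgroups *)

(** The segments [0, N) stand for arbitrary finite sets: the image of [0, N) under
[h] meets [0, N) only in fixed points of [h], and [n0] is not one of them. *)
Definition mobile (G : topologicalGroupType) (a : G -> symN) (H : set G)
    (n0 : nat) :=
  forall N, exists h, [/\ H h,
    forall b, (b < N)%N -> a h b = b \/ (N <= a h b)%N & (N <= a h n0)%N].

(** Call [b] settled if [a h b] is constant for [F]-many [h].  Pick [j] that
takes the constant value at each settled [b], then [k] that does the same and
avoids [a j c], [c < N], at each unsettled [b]; both choices only exclude small
sets.  Then [j^-1 k] fixes the settled points and pushes away the others. *)
Lemma fix_or_move_away (G : topologicalGroupType) (a : G -> symN) (H : set G)
    (F : set_system G) (n0 : nat) :
  fundamental_action a -> is_subgroup H -> ProperFilter F ->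
  (forall A, F A \/ F (~` A)) -> F H -> (forall m, ~ F [set h | a h n0 = m]) ->
  mobile a H n0.
Proof.
move=> fund_a [H1 HM HV] FF FU FH Fn0 N.
pose settled b := exists m, F [set h | a h b = m].
have unsettled b m : ~ settled b -> F [set h | a h b <> m].
  by move=> nb; have [Fm|//] := FU [set h | a h b = m]; case: nb; exists m.
(* The point n0 need not be below N, but has to be treated with the others. *)
pose M := maxn N n0.+1.
have [j [Hj jP]] : exists j, H j /\ forall b, (b < M)%N ->
    settled b -> F [set h | a h b = a j b].
  apply: (@filter_ex _ F); apply: filterI FH _.
  apply: (@near_forall_ltn _ F _
    (fun b j => settled b -> F [set h | a h b = a j b])).
  move=> b _; have [[m Fm]|nb] := pselect (settled b); last by apply: nearW => j /nb.
  by apply: filterS (Fm) => j /= jm _; rewrite jm.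
have [k [Hk kP]] : exists k, H k /\ forall b, (b < M)%N ->
    (settled b -> a k b = a j b) /\
    (~ settled b -> forall c, (c < N)%N -> a k b <> a j c).
  apply: (@filter_ex _ F); apply: filterI FH _.
  apply: (@near_forall_ltn _ F _ (fun b k => (settled b -> a k b = a j b) /\
    (~ settled b -> forall c, (c < N)%N -> a k b <> a j c))).
  move=> b bM; have [sb|nb] := pselect (settled b).
    by apply: filterS (jP b bM sb) => k /= ->; split.
  have : \forall k \near F, forall c, (c < N)%N -> a k b <> a j c.
    apply: (@near_forall_ltn _ F _ (fun c k => a k b <> a j c)) => c _.
    exact: unsettled.
  by apply: filterS => k kc; split.
have [aM _ _ _] := fund_a.
have hE b : a (j^-1 * k)%g b = symN_inv (a j) (a k b).
  by rewrite aM fundamental_actionV.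
have away b : (b < M)%N -> ~ settled b -> (N <= a (j^-1 * k)%g b)%N.
  move=> bM nb; rewrite leqNgt; apply/negP => lt.
  by apply: ((kP b bM).2 nb _ lt); rewrite hE symN_invK.
exists (j^-1 * k)%g; split; first by apply: HM => //; apply: HV.
  move=> b bN; have bM : (b < M)%N by rewrite leq_max bN.
  have [sb|nb] := pselect (settled b); last by right; exact: away.
  by left; rewrite hE (kP b bM).1// symN_funK.
by apply: away; [rewrite leq_max ltnSn orbT|case=> m /Fn0].
Qed.

(** An ultrafilter on [H] without limit cannot settle both all values [a h b] and
all values [a h^-1 b].  In the second case its image under inversion, which
still contains [H], is the one to use. *)
Lemma noncompact_open_subgroup_mobile (G : topologicalGroupType) (a : G -> symN)
    (H : set G) :
  fundamental_action a -> open H -> is_subgroup H -> ~ compact H ->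
  exists n0, mobile a H n0.
Proof.
move=> fund_a oH sH; rewrite compact_ultra => /existsNP[F].
move=> /not_implyP[UF /not_implyP[FH nolim]].
have FU A : F A \/ F (~` A) by exact: in_ultra_setVsetC.
have FF : ProperFilter F by exact: ultra_proper.
have [settled|/existsNP[b /forallNP]] :=
  pselect (forall b, exists m, F [set h | a h b = m]); last first.
  by move=> Fb; exists b; exact: (fix_or_move_away fund_a sH FF FU FH Fb).
have [settledV|/existsNP[b /forallNP]] :=
  pselect (forall b, exists m, F [set h | a (h^-1)%g b = m]); last first.
  move=> Fb; exists b.
  apply: (@fix_or_move_away _ a H ((fun h => (h^-1)%g) @ F)) => //.
  - by move=> A; exact: (FU ((fun h => (h^-1)%g) @^-1` A)).
  - have [_ _ HV] := sH; exact: (filterS HV FH).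
have [g Fg] := pointwise_cvg_fundamental FF fund_a settled settledV.
case: nolim; exists g; split=> //.
apply: (open_subgroup_closed oH sH) => B /Fg FB; exact: filter_ex (filterI FH FB).
Qed.

(** * Orbits of the Bernoulli shift *)

Lemma bernoulliM (R : realType) (G : topologicalGroupType) (a : G -> symN)
    (g h : G) (x : {ptws nat -> R}) :
  fundamental_action a ->
  bernoulli a (g * h)%g x = bernoulli a g (bernoulli a h x).
Proof.
by case=> aM _ _ _; apply/funext => n; rewrite /bernoulli invgM aM.
Qed.

Lemma bernoulli1 (R : realType) (G : topologicalGroupType) (a : G -> symN)
    (x : {ptws nat -> R}) :
  fundamental_action a -> bernoulli a 1%g x = x.
Proof.
by move=> fund_a; apply/funext => n; rewrite /bernoulli invg1 fundamental_action1.
Qed.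

Lemma act_orbit_bernoulli (R : realType) (G : topologicalGroupType) (a : G -> symN)
    (g : G) (x : {ptws nat -> R}) :
  fundamental_action a ->
  act_orbit (bernoulli a) (bernoulli a g x) = act_orbit (bernoulli a) x.
Proof.
move=> fund_a; apply/seteqP; split=> _ [h _ <-].
  by exists (h * g)%g => //; rewrite bernoulliM.
by exists (h * g^-1)%g => //; rewrite -bernoulliM// -mulgA mulVg mulg1.
Qed.

(** The group elements [g n] have a cluster point [k] in [K].  As each coordinate
of the action is locally constant in the group variable, coordinate [i] of
[g n gs x] equals that of [k gs x] for infinitely many [n]. *)
Lemma succeq_compact_orbit (R : realType) (G : topologicalGroupType)
    (a : G -> symN) (V K : set G) (x y : {ptws nat -> R}) :
  fundamental_action a -> compact K -> V `<=` K ->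
  succeq (bernoulli a) V x y ->
  act_orbit (bernoulli a) x = act_orbit (bernoulli a) y.
Proof.
move=> fund_a cK VK [gs [g [Vg /ptws_cvgP gxy]]].
have [|k [_ clk]] := cK (g @ \oo) _.
  by exists 0%N => // n _; apply: VK.
suff <- : bernoulli a (k * gs)%g x = y by rewrite act_orbit_bernoulli.
apply/funext => i; apply: contrapT => neq.
pose d := `|y i - bernoulli a (k * gs)%g x i|.
have d0 : 0 < d by rewrite normr_gt0 subr_eq0; apply/eqP => /esym.
have knear : nbhs k
    [set h | bernoulli a (h * gs)%g x i = bernoulli a (k * gs)%g x i].
  have cont : {for k, continuous (fun h : G => (h * gs)^-1%g)}.
    have kgs : (h * gs)%g @[h --> k] --> (k * gs)%g.
      exact: (@mulg_cvg _ G (nbhs k) _ id (fun=> gs) k gs cvg_id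
        (cvg_cst gs)).
    exact: (cvg_comp _ _ kgs (@invg_continuous G (k * gs)%g)).
  have near_k : nbhs k [set h | a ((h * gs)^-1)%g i = a ((k * gs)^-1)%g i].
    exact: (cont _ (fundamental_action_near_eq ((k * gs)^-1)%g i fund_a)).
  by apply: filterS near_k => h /= e; rewrite /bernoulli e.
have /cvgrPdist_lt/(_ d d0) far := gxy i.
have [_ [[n /= nd <-] nk]] :
    [set g n | n in [set n | `|y i - bernoulli a (g n * gs)%g x i| < d]] `&`
    [set h | bernoulli a (h * gs)%g x i = bernoulli a (k * gs)%g x i] !=set0.
  by apply: clk => //; apply: filterS far => n /= nd; exists n.
by move: nd; rewrite nk ltxx.
Qed.

(** * Raising one value of a generic sequence *)

Definition raise (R : realType) (n0 : nat) (t : R) (x : {ptws nat -> R}) :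
  {ptws nat -> R} := fun n => x n + (n == n0)%:R * t.

Lemma raise_continuous (R : realType) n0 (t : R) : continuous (raise n0 t).
Proof.
move=> x.
apply/(@ptws_cvgP R _ (nbhs x) _ (raise n0 t)) => n.
exact: (cvgD (@eval_continuous R n x) (cvg_cst ((n == n0)%:R * t))).
Qed.

Lemma raiseK (R : realType) n0 (t : R) : cancel (raise n0 t) (raise n0 (- t)).
Proof. by move=> x; apply/funext => n; rewrite /raise mulrN addrK. Qed.

(** If [o n0 + 1 = o m] then [m] is not [n0], and a small change of [o m] breaks
the equality. *)
Lemma raise_avoids_value (R : realType) (n0 m : nat) :
  nowhere_dense (~` [set o : {ptws nat -> R} | o n0 + 1 != o m]).
Proof.
have [->|mn0] := eqVneq m n0.
  rewrite (_ : [set _ | _] = setT) ?setCT /nowhere_dense ?closure0 ?interior0//.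
  by apply/seteqP; split=> // o _ /=; rewrite -subr_eq0 addrAC subrr add0r oner_neq0.
apply: open_dense_nowhere_denseC.
  pose gap (z : {ptws nat -> R}) : R := z n0 + 1 - z m.
  have gap_cont : continuous gap.
    move=> z; exact: (cvgB (cvgD (@eval_continuous R n0 z) (cvg_cst (1 : R)))
      (@eval_continuous R m z)).
  rewrite (_ : [set _ | _] = gap @^-1` [set y | y != 0]).
    by apply: open_comp => [z _|]; [exact: gap_cont|exact: open_neq].
  by apply/seteqP; split=> z; rewrite /gap /= subr_eq0.
move=> o U /nbhs_box[n sub].
have [om|om] := eqVneq (o n0 + 1) (o m); last first.
  by exists o => //; apply: sub => i _; rewrite subrr normr0 invr_ge0 ler0n.
exists (raise m n.+1%:R^-1 o).
  apply: sub => i _; rewrite /raise addrAC subrr add0r.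
  case: eqP => _; last by rewrite mul0r normr0 invr_ge0 ler0n.
  by rewrite mul1r ger0_norm// invr_ge0 ler0n.
rewrite /raise /= eqxx [n0 == m]eq_sym (negbTE mn0) mul0r addr0 mul1r om.
by rewrite -subr_eq0 opprD addNKr oppr_eq0 invr_eq0 pnatr_eq0.
Qed.

(** Density: keep [o] on a long interval [0, M) containing [n0], and elsewhere
copy [o] along [h], which exists because [n0] is mobile.  For [b < N] the value
of the raised sequence at [h b] is then exactly that at [b] of the new one:
either [h b] is at least [M], or [h b = b], and then [b] is not [n0]. *)
Lemma raise_approximable (R : realType) (G : topologicalGroupType)
    (a : G -> symN) (H : set G) (n0 N : nat) :
  fundamental_action a ->
  mobile a H n0 ->
  nowhere_dense (~` [set o : {ptws nat -> R} | exists2 h, H h &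
    forall b, (b < N)%N -> `|raise n0 1 o (a h b) - o b| < N.+1%:R^-1]).
Proof.
move=> fund_a moves; apply: open_dense_nowhere_denseC.
  rewrite openE => o [h Hh ho] /=.
  have : \forall o' \near o, forall b, (b < N)%N ->
      `|raise n0 1 o' (a h b) - o' b| < N.+1%:R^-1.
    apply: (@near_forall_ltn _ (nbhs o) _ (fun b o' =>
      `|raise n0 1 o' (a h b) - o' b| < N.+1%:R^-1)) => b bN.
    have ev : (fun z : {ptws nat -> R} => `|raise n0 1 z (a h b) - z b|) @ o -->
              `|raise n0 1 o (a h b) - o b|.
      exact: (cvg_norm (cvgB (cvgD (@eval_continuous R (a h b) o)
        (cvg_cst ((a h b == n0)%:R * 1 : R))) (@eval_continuous R b o))).
    by have := cvgr_lt _ ev _ (ho b bN); exact.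
  by apply: filterS => o' ho'; exists h.
move=> o U /nbhs_box[n sub].
pose M := maxn (maxn N n) n0.+1.
have [h [Hh hb hn0]] := moves M.
pose p : {ptws nat -> R} :=
  fun m => if (m < M)%N then o m else o (symN_inv (a h) m).
have pE m : (m < M)%N -> p m = o m by move=> mM; rewrite /p mM.
exists p.
  apply: sub => i iN; rewrite pE ?subrr ?normr0 ?invr_ge0 ?ler0n//.
  by rewrite !leq_max iN orbT.
exists h => // b bN; have bM : (b < M)%N by rewrite !leq_max bN.
suff -> : raise n0 1 p (a h b) = p b by rewrite subrr normr0 invr_gt0 ltr0Sn.
have n0M : (n0 < M)%N by rewrite !leq_max ltnSn !orbT.
rewrite /raise; have [hbb|hbM] := hb b bM.
  rewrite hbb; case: eqP => [bn0|_]; last by rewrite mul0r addr0.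
  by move: hn0; rewrite -bn0 hbb leqNgt bM.
rewrite [p b]pE// /p ltnNge hbM /= symN_funK.
by case: eqP => [e|_]; [move: hbM; rewrite e leqNgt n0M|rewrite mul0r addr0].
Qed.

(** * Failure of local compactness *)

Unset Implicit Arguments.

Theorem mainTheorem7 (R : realType) (G : topologicalGroupType)
    (polishG : polish R G) (nonarchG : non_archimedean G)
    (a : G -> symN) (fund_a : fundamental_action a) :
  ~ locally_compact [set: G] <->
  (forall (V : set G) (C O : set {ptws nat -> R}),
     open_nbhs (1%g : G) V ->
     act_invariant (bernoulli a) C -> comeager C ->
     ~ meager O ->
     exists c o : {ptws nat -> R},
       [/\ C c, O o, succeq (bernoulli a) V c o &
           act_orbit (bernoulli a) c <> act_orbit (bernoulli a) o]).
Proof.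
split=> [nlc V C O V1 _ [F Fnd CF] Onm|rich lc]; last first.
  have [K wK1 [cK _]] := lc 1%g I.
  have K1 : nbhs (1%g : G) K by exact: (filterS (fun x wx => wx I) wK1).
  have [| | |c [ o [_ _ co []]]] := rich (K°) setT setT _ _ _ (@baire_sequence_space R).
  - by split; [exact: open_interior|exact: K1].
  - by [].
  - exists (fun=> set0); last by rewrite setCT.
    by move=> _; rewrite /nowhere_dense closure0 interior0.
  - exact: succeq_compact_orbit fund_a cK (@interior_subset _ K) co.
have [H [oH sH HV]] := nonarchG V (open_nbhs_nbhs V1).
have ncH : ~ compact H.
  by move=> cH; apply: nlc; exact: compact_open_subgroup_locally_compact oH sH cH.
have [n0 moves] := noncompact_open_subgroup_mobile fund_a oH sH ncH.
pose C' := [set o | C (raise n0 1 o)].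
pose D m := [set o : {ptws nat -> R} | o n0 + 1 != o m].
pose W N := [set o : {ptws nat -> R} | exists2 h, H h &
    forall b, (b < N)%N -> `|raise n0 1 o (a h b) - o b| < N.+1%:R^-1].
have C'm : meager (~` C').
  exists (fun n => raise n0 1 @^-1` F n) => [n|o /CF[n _ Fn]]; last by exists n.
  apply: nowhere_dense_preimage (@raiseK R n0 1) _ (Fnd n).
  - exact: raise_continuous.
  - exact: raise_continuous.
  - by move=> x; rewrite -[in RHS](raiseK n0 (-1) x) opprK.
have Dm : meager (~` \bigcap_m D m).
  exists (fun m => ~` D m); last by rewrite setC_bigcap.
  by move=> m; exact: raise_avoids_value.
have Wm : meager (~` \bigcap_m W m).
  exists (fun m => ~` W m); last by rewrite setC_bigcap.
  by move=> m; exact: raise_approximable.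
have [ o [Oo C'o Do Wo]] : exists o,
    [/\ O o, C' o, (\bigcap_m D m) o & (\bigcap_m W m) o].
  apply: contrapT => /forallNP none; apply: Onm.
  have [E End sub] := meagerU C'm (meagerU Dm Wm).
  exists E => // o Oo; apply: sub; apply: contrapT => /not_orP[/contrapT ? ].
  by move=> /not_orP[/contrapT ? /contrapT ?]; exact: (none o).
exists (raise n0 1 o), o; split=> //.
  have /choice[h hP] N : exists h, H h /\ forall b, (b < N)%N ->
      `|raise n0 1 o (a h b) - o b| < N.+1%:R^-1.
    by have [h] := Wo N I; exists h.
  have [_ _ HVg] := sH.
  (* The shift by g composes with g^-1, so the group elements are inverses. *)
  exists 1%g, (fun n => (h n)^-1%g); split=> [n|].
    by apply/HV/HVg; have [] := hP n.
  apply/ptws_cvgP => i; apply/cvgrPdist_lt => e e0; near=> n.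
  rewrite /= /bernoulli mulg1 invgK distrC.
  apply: lt_trans ((hP n).2 i _) _; first by near: n; exists i.+1.
  by near: n; exact: (near_infty_natSinv_lt (PosNum e0)).
move=> orbE.
have [g _ gE] : act_orbit (bernoulli a) o (raise n0 1 o).
  by rewrite -orbE; exists 1%g => //; rewrite bernoulli1.
(* The value o n0 + 1 of the raised sequence at n0 is a value of o. *)
have /negP[] := Do (a (g^-1)%g n0) I.
by have := congr1 (@^~ n0) gE; rewrite /bernoulli /raise eqxx mul1r => ->.
Unshelve. all: by end_near. Qed.
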